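(* Let $f=\sum_{i=1}^{r}\Delta^{m_i}\in\mathbb{F}_2[\Delta]$ be a nonzero cusp form mod 2, where $m_1,\dots,m_r$ ($r\ge 1$) are distinct positive integers. Let $\nu_2$ denote the 2-adic valuation, let $v=\max_i\{\nu_2(m_i)\}$, and for $0\le j\le v$ set $f_j=\sum_{i:\,\nu_2(m_i)=j}\Delta^{m_i}$ (an empty sum being $0$), so that $f=\sum_{j=0}^{v}f_j$. Then: (1) For each $0\le j\le v$, \[ d(f_j)=j+d\Big(\sum_{i:\,\nu_2(m_i)=j}\Delta^{m_i/2^j}\Big). \] (2) The degree of nilpotency of $f$ is \[ d(f)=\max_{0\le j\le v}\{d(f_j)\}. \]
   Context: $\Delta=\Delta(q)=q\prod_{n\ge1}(1-q^n)^{24}$, with coefficients reduced mod 2, is viewed as an element of $\mathbb{F}_2[[q]]$. The ring of modular forms mod 2 (reductions mod 2 of modular forms on $\mathrm{SL}_2(\mathbb{Z})$ with integer Fourier coefficients) is the polynomial ring $\mathbb{F}_2[\Delta]$; its cusp forms are the polynomials in $\Delta$ with zero constant term. Hecke operators act on a cusp form $f=\sum_{n\ge1}a(n)q^n$ mod 2 by $T_p\mid f=\sum_{n\ge1}(a(pn)+a(n/p))q^n$ for odd primes $p$ (with $a(n/p)=0$ if $p\nmid n$), and $T_2\mid f=\sum_{n\ge1}a(2n)q^n$. The degree of nilpotency $d(f)$ of a nonzero cusp form $f\in\mathbb{F}_2[\Delta]$ is the smallest integer $d$ such that $T_{p_1}T_{p_2}\cdots T_{p_d}\mid f=0$ for every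 collection of $d$ primes $p_1,\dots,p_d$ (not necessarily distinct, and $p_i=2$ is allowed). Set $d(0)=-\infty$, with $j+(-\infty)=-\infty$. *)

(* Defs.v *)
From HB Require Import structures.
From mathcomp Require Import all_boot all_order all_algebra.
From mathcomp Require Import boolp classical_sets functions constructive_ereal.

Set Implicit Arguments.
Unset Strict Implicit.
Unset Printing Implicit Defensive.

Import Order.TTheory GRing.Theory Num.Theory.
Local Open Scope ring_scope.

(* R[[q]], a power series being its sequence of coefficients. Addition is
   pointwise; multiplication is the Cauchy product, NOT the pointwise product
   that [functions] puts on [nat -> R]. *)
Definition fps (R : comNzRingType) : Type := nat -> R.

HB.instance Definition _ (R : comNzRingType) := Choice.on (fps R).
HB.instance Definition _ (R : comNzRingType) := GRing.Zmodule.on (fps R).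

Section FpsRing.
Variable R : comNzRingType.
Implicit Types f g h : fps R.

Definition fps_one : fps R := fun n => (n == 0%N)%:R.
Definition fps_mul f g : fps R := fun n => \sum_(i < n.+1) f i * g (n - i)%N.

Let trunc n f : {poly R} := \poly_(i < n.+1) f i.

Let coef_trunc n f k : (k <= n)%N -> (trunc n f)`_k = f k.
Proof. by move=> kn; rewrite coef_poly ltnS kn. Qed.

Let coef_truncM n f g k : (k <= n)%N ->
  (trunc n f * trunc n g)`_k = fps_mul f g k.
Proof.
move=> kn; rewrite coefM; apply: eq_bigr => i _.
rewrite !coef_trunc //; first exact: leq_trans (leq_subr _ _) kn.
by apply: leq_trans kn; rewrite -ltnS.
Qed.

Let fps_mulC : commutative fps_mul.
Proof. by move=> f g; apply/funext => n; rewrite -!(@coef_truncM n) // mulrC. Qed.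

Let fps_mulA : associative fps_mul.
Proof.
move=> f g h; apply/funext => n.
have L : fps_mul f (fps_mul g h) n = (trunc n f * (trunc n g * trunc n h))`_n.
  rewrite coefM; apply: eq_bigr => i _.
  by rewrite coef_trunc ?coef_truncM ?leq_subr // -ltnS.
rewrite L mulrA coefM; apply: eq_bigr => i _.
by rewrite coef_trunc ?leq_subr // coef_truncM // -ltnS.
Qed.

Let fps_mul1 : left_id fps_one fps_mul.
Proof.
move=> f; apply/funext => n; rewrite /fps_mul big_ord_recl /= subn0 mul1r.
by rewrite big1 ?addr0 // => i _; rewrite mul0r.
Qed.

Let fps_mulDl : left_distributive fps_mul +%R.
Proof.
move=> f g h; apply/funext => n.
have -> : (fps_mul f h + fps_mul g h) n = fps_mul f h n + fps_mul g h n by [].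
by rewrite /fps_mul -big_split; apply: eq_bigr => i _; exact: mulrDl.
Qed.

Let fps_one_neq0 : fps_one != 0 :> fps R.
Proof.
apply/eqP => /(congr1 (fun f : fps R => f 0%N)) /eqP.
by rewrite /fps_one /= (oner_eq0 R).
Qed.

HB.instance Definition _ := GRing.Zmodule_isComNzRing.Build (fps R)
  fps_mulA fps_mulC fps_mul1 fps_mulDl fps_one_neq0.

Lemma fps_coefM f g n : (f * g) n = \sum_(i < n.+1) f i * g (n - i)%N.
Proof. by []. Qed.

Lemma fps_coefD f g n : (f + g) n = f n + g n.
Proof. by []. Qed.

End FpsRing.

Definition Delta_trunc (N : nat) : {poly int} :=
  'X * \prod_(1 <= k < N.+1) (1 - 'X^k) ^+ 24.

(* The factors with k > n do not affect the coefficient of q^n; see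
   Delta_int_stable. *)
Definition Delta_int : fps int := fun n => (Delta_trunc n)`_n.

Lemma Delta_int_stable n N : (n <= N)%N -> (Delta_trunc N)`_n = Delta_int n.
Proof.
elim: N => [|N IHN]; first by rewrite leqn0 => /eqP ->.
rewrite leq_eqVlt => /predU1P[-> //|]; rewrite ltnS => nN.
rewrite -IHN // /Delta_trunc big_nat_recr //= mulrA.
set A := 'X * _.
have [B ->] : exists B : {poly int}, (1 - 'X^(N.+1)) ^+ 24 = 1 + B * 'X^(N.+1).
  elim: 24%N => [|e [B IHe]]; first by exists 0; rewrite mul0r addr0 expr0.
  exists (B * (1 - 'X^(N.+1)) - 1); rewrite exprSr IHe mulrDl mul1r.
  rewrite mulrBl mul1r -addrA; congr (1 + _).
  by rewrite addrC mulrAC.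
by rewrite mulrDr mulr1 coefD mulrA coefMXn ltnS nN addr0.
Qed.

Definition Delta : fps 'F_2 := fun n => (Delta_int n)%:~R.

(* Only used for p prime. Mod 2 the Hecke operator at p = 2 has no a(n/p)
   term. *)
Definition hecke (p : nat) (f : fps 'F_2) : fps 'F_2 := fun n =>
  if n == 0%N then 0
  else if p == 2%N then f (2 * n)%N
  else f (p * n)%N + (if (p %| n)%N then f (n %/ p)%N else 0).

Definition killed_by_products (f : fps 'F_2) (d : nat) : Prop :=
  forall ps : seq nat, size ps = d -> all prime ps -> foldr hecke f ps = 0.

(* The value +oo means that no such d exists; for f in F_2[Delta] this never
   happens, by the (known) nilpotency of the Hecke action mod 2. *)
Definition nildeg (f : fps 'F_2) : \bar int :=
  if f == 0 then -oo%E
  else if pselect (exists d, `[< killed_by_products f d >]) is left ex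
  then ((ex_minn ex)%:Z)%:E
  else +oo%E.

(* Main.v *)
(* Write V for the substitution q -> q^2, which over F_2 is also the squaring
   map. Modulo 2 the eta product of Delta is a square times q, so Delta has only
   odd exponents, and Delta^m has exponents n with nu_2(n) = nu_2(m) only.
   For (1), f_j = V^j g_j, where T_2 V = id and each odd T_p commutes
   with V and with T_2: a product of d+1 operators kills V g iff every product
   of d operators kills g. For (2), odd T_p preserve the decomposition of a
   series according to nu_2(n) and T_2 shifts it, so a product of Hecke
   operators kills f iff it kills each f_j. *)
Require Import Defs.
From HB Require Import structures.
From mathcomp Require Import all_boot all_order all_algebra.
From mathcomp Require Import boolp classical_sets functions constructive_ereal.

Set Implicit Arguments.
Unset Strict Implicit.
Unset Printing Implicit Defensive.

Import Order.TTheory GRing.Theory Num.Theory.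
Local Open Scope ring_scope.

(** * The dilation V, squaring over ['F_2], and the exponents in powers of [Delta] *)

Definition fps_dilate2 (f : fps 'F_2) : fps 'F_2 :=
  fun n => if odd n then 0 else f n./2.

(** The guard [0 < n] matters because [logn 2 0 = 0]: without it the constant term would fall into
    part 0. *)
Definition fps_val2_part (k : nat) (f : fps 'F_2) : fps 'F_2 :=
  fun n => if (0 < n)%N && (logn 2 n == k) then f n else 0.

Lemma coef_sqrp_F2 (p : {poly 'F_2}) n :
  (p * p)`_n = if odd n then 0 else p`_n./2.
Proof.
have char2 : 2%N \in [pchar {poly 'F_2}] by rewrite pchar_poly pchar_Fp.
have sqrF2 (c : 'F_2) : c * c = c.
  by case: c => [[|[|k]] ck] //; apply/val_inj.
elim/poly_ind: p n => [|p c IHp] n; first by rewrite mulr0 !coef0 if_same.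
(* Frobenius is additive in characteristic 2, so the cross terms vanish, and [c * c = c] in
   ['F_2]. *)
have -> : (p * 'X + c%:P) * (p * 'X + c%:P) = p * p * 'X^2 + c%:P.
  have := pFrobenius_autD_comm char2 (mulrC (p * 'X) c%:P).
  by rewrite !pFrobenius_autE expr2 => ->; rewrite exprMn !expr2 -polyCM sqrF2.
rewrite !coefD coefMXn !coefC coefMX.
case: n => [|[|n]] //=; first by rewrite addr0.
by rewrite subn2 /= IHp negbK addr0; case: odd; rewrite ?addr0.
Qed.

(** Coefficient n of a product involves only coefficients up to n, so the polynomial case applies to
    a truncation. *)
Lemma fps_sqr_F2 (f : fps 'F_2) : f * f = fps_dilate2 f.
Proof.
apply/funext => n; rewrite fps_coefM.
pose p : {poly 'F_2} := \poly_(i < n.+1) f i.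
have pE i : (i <= n)%N -> p`_i = f i by move=> le_in; rewrite coef_poly ltnS le_in.
have := coef_sqrp_F2 p n; rewrite coefM pE;
  last by rewrite leq_half_double -addnn -addnS leq_addr.
rewrite /fps_dilate2 => <-; apply: eq_bigr => i _; rewrite !pE ?leq_subr //.
by rewrite -ltnS.
Qed.

Lemma Delta_even n : ~~ odd n -> Delta n = 0.
Proof.
move=> n_even; rewrite /Delta /Delta_int.
rewrite -(coef_map (intr : int -> 'F_2)) /Delta_trunc.
(* Splitting 24 as 12 + 12 makes the product a square, hence even mod 2; the factor ['X] shifts it
   to odd exponents. *)
rewrite (eq_bigr (fun k => (1 - 'X^k) ^+ 12 * (1 - 'X^k) ^+ 12)); last first.
  by move=> k _; rewrite -exprD.
rewrite big_split rmorphM /= map_polyX rmorphM /= mulrC coefMX.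
by case: n n_even => [|n] //=; rewrite negbK coef_sqrp_F2 => ->.
Qed.

Lemma fps_dilate2D : {morph fps_dilate2 : f g / f + g}.
Proof.
by move=> f g; apply/funext => n; rewrite fps_coefD /fps_dilate2;
  case: odd; rewrite ?addr0.
Qed.

Lemma fps_dilate2_0 : fps_dilate2 0 = 0.
Proof. by apply/funext => n; rewrite /fps_dilate2 if_same. Qed.

Lemma fps_val2_partD k : {morph fps_val2_part k : f g / f + g}.
Proof.
by move=> f g; apply/funext => n; rewrite fps_coefD /fps_val2_part;
  case: ifP; rewrite ?addr0.
Qed.

Lemma fps_val2_part0 k : fps_val2_part k 0 = 0.
Proof. by apply/funext => n; rewrite /fps_val2_part if_same. Qed.

Lemma logn2_odd n : odd n -> logn 2 n = 0%N.
Proof. by move=> n_odd; rewrite lognE dvdn2 n_odd andbF. Qed.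

Lemma fps_val2_part_dilate2 k (f : fps 'F_2) :
  fps_val2_part k.+1 (fps_dilate2 f) = fps_dilate2 (fps_val2_part k f).
Proof.
apply/funext => n; rewrite /fps_val2_part /fps_dilate2.
case: (boolP (odd n)) => n_odd; first by rewrite if_same.
rewrite -{1 2}(even_halfK n_odd) double_gt0 -muln2 mulnC.
case: n./2 => // h /=; by rewrite lognM // logn_prime.
Qed.

Lemma fps_val2_part_odd (f : fps 'F_2) :
  (forall n, ~~ odd n -> f n = 0) -> fps_val2_part 0 f = f.
Proof.
move=> f_odd; apply/funext => n; rewrite /fps_val2_part.
have [n_odd|n_even] := boolP (odd n); first by rewrite odd_gt0 ?logn2_odd.
by rewrite f_odd ?if_same.
Qed.

(** An odd power is [Delta] times a square. For even n, each term of the Cauchy product pairs two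
    indices of equal parity: [Delta] vanishes on the even ones, the square on the odd ones. *)
Lemma Delta_exp_odd m n : odd m -> ~~ odd n -> (Delta ^+ m) n = 0.
Proof.
move=> m_odd n_even; rewrite -[m]odd_double_half m_odd exprD expr1 -addnn exprD.
rewrite fps_sqr_F2 fps_coefM big1 // => i _; rewrite /fps_dilate2.
have [i_odd|i_even] := boolP (odd i); last by rewrite Delta_even ?mul0r.
have i_le : (i <= n)%N by rewrite -ltnS.
have ni_odd : odd (n - i) by rewrite oddB // (negbTE n_even) i_odd.
rewrite ni_odd.
exact: mulr0.
Qed.

(** Strong induction by halving: for even m the power is the dilation of [Delta ^+ m./2], which
    raises the valuation by one; odd m is the base. *)
Lemma Delta_exp_val2 m : (0 < m)%N ->
  fps_val2_part (logn 2 m) (Delta ^+ m) = Delta ^+ m.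
Proof.
elim/ltn_ind: m => m IHm m_gt0; have [m_odd|m_even] := boolP (odd m).
  rewrite logn2_odd // fps_val2_part_odd // => n; exact: Delta_exp_odd.
rewrite -(even_halfK m_even) double_gt0 in m_gt0 *.
rewrite -{1}muln2 mulnC lognM // logn_prime //= add1n -addnn exprD fps_sqr_F2.
rewrite fps_val2_part_dilate2 IHm // -{1}[m./2]addn0 -(even_halfK m_even) doubleK.
by rewrite -addnn ltn_add2l.
Qed.

Lemma fps_val2_part_Delta_exp k m : (0 < m)%N ->
  fps_val2_part k (Delta ^+ m) = if logn 2 m == k then Delta ^+ m else 0.
Proof.
move=> m_gt0; have [<-|m_k] := eqVneq (logn 2 m) k; first exact: Delta_exp_val2.
rewrite -Delta_exp_val2 //; apply/funext => n; rewrite /fps_val2_part.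
case: (0 < n)%N => //=; case: (logn 2 n =P k) => // ->.
by rewrite eq_sym (negbTE m_k).
Qed.

(** Every 2-adic part vanishes at index 0, by the guard in [fps_val2_part]. *)
Lemma Delta_exp0 m : (0 < m)%N -> (Delta ^+ m) 0%N = 0.
Proof. by move/Delta_exp_val2 <-. Qed.

(** * Hecke operators and their interaction with dilation *)

Lemma hecke0 p : hecke p 0 = 0.
Proof. by apply/funext => n; rewrite /hecke !if_same addr0 !if_same. Qed.

Lemma foldr_hecke0 ps : foldr hecke 0 ps = 0.
Proof. by elim: ps => //= p ps ->; exact: hecke0. Qed.

Lemma heckeD p : {morph hecke p : f g / f + g}.
Proof.
move=> f g; apply/funext => n; rewrite fps_coefD /hecke !fps_coefD.
by do !case: ifP => _; rewrite ?addr0 // addrACA.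
Qed.

Lemma foldr_heckeD ps : {morph (foldr hecke)^~ ps : f g / f + g}.
Proof. by move=> f g; elim: ps => //= p ps ->; exact: heckeD. Qed.

Lemma odd_prime_neq2 p : prime p -> p != 2%N -> odd p.
Proof. by move=> /even_prime[->|]. Qed.

Lemma hecke2_comm p (f : fps 'F_2) : prime p ->
  hecke 2 (hecke p f) = hecke p (hecke 2 f).
Proof.
have [-> //|p_neq2 p_prime] := eqVneq p 2%N.
have p_gt0 := prime_gt0 p_prime.
have p_odd := odd_prime_neq2 p_prime p_neq2.
have co_p2 : coprime p 2 by rewrite coprimen2.
apply/funext => -[|n] //; rewrite /hecke (negbTE p_neq2) /=.
rewrite Gauss_dvdr // mulnCA [(p * _ == 0)%N]gtn_eqF ?muln_gt0 ?p_gt0 //.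
(* The quotient by p is positive, so the value 0 that [hecke] assigns at index 0 does not
   intervene. *)
case: ifP => // p_n; rewrite gtn_eqF ?muln_divA //.
by rewrite divn_gt0 // dvdn_leq.
Qed.

(** The hypothesis is needed at index 0, where [hecke] always returns 0. *)
Lemma hecke2_dilate2 (f : fps 'F_2) : f 0%N = 0 -> hecke 2 (fps_dilate2 f) = f.
Proof.
move=> f0; apply/funext => -[|n] //.
by rewrite /hecke /fps_dilate2 mul2n odd_double doubleK.
Qed.

(** At odd n both sides vanish, since [p * n] and [n %/ p] (when p divides n) are odd. At n = 2h, p
    divides 2h exactly when it divides h. *)
Lemma hecke_dilate2 p (f : fps 'F_2) : odd p -> prime p ->
  hecke p (fps_dilate2 f) = fps_dilate2 (hecke p f).
Proof.
move=> p_odd p_prime; have p_neq2 : p != 2%N by apply: contraTneq p_odd => ->.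
apply/funext => n; rewrite /hecke /fps_dilate2 (negbTE p_neq2).
rewrite oddM p_odd /=; have [n_odd|n_even] := boolP (odd n).
  rewrite gtn_eqF ?odd_gt0 // add0r; case: ifP => // p_n.
  by move: n_odd; rewrite -{1}(divnK p_n) oddM => /andP[->].
rewrite -(even_halfK n_even); set h := n./2; rewrite doubleK double_eq0.
have co_p2 : coprime p 2 by rewrite coprimen2.
rewrite -!mul2n mulnCA Gauss_dvdr // !mul2n doubleK.
case: (h == 0%N) => //; congr (_ + _); case: ifP => // p_h.
by rewrite -mul2n -muln_divA // mul2n odd_double doubleK.
Qed.

Lemma foldr_hecke_dilate2 ps (f : fps 'F_2) : all odd ps -> all prime ps ->
  foldr hecke (fps_dilate2 f) ps = fps_dilate2 (foldr hecke f ps).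
Proof.
elim: ps => //= p ps IHps /andP[p_odd ps_odd] /andP[p_prime ps_prime].
by rewrite IHps // hecke_dilate2.
Qed.

Lemma foldr_hecke_hecke2 ps (f : fps 'F_2) : all prime ps ->
  foldr hecke (hecke 2 f) ps = hecke 2 (foldr hecke f ps).
Proof.
elim: ps => //= p ps IHps /andP[p_prime ps_prime].
by rewrite IHps // hecke2_comm.
Qed.

(** As T_2 commutes with every T_p, one occurrence of it can be moved innermost and so applied
    first. *)
Lemma foldr_hecke_rem2 ps (f : fps 'F_2) : all prime ps -> 2%N \in ps ->
  foldr hecke f ps = foldr hecke (hecke 2 f) (rem 2%N ps).
Proof.
elim: ps => //= p ps IHps /andP[p_prime ps_prime]; rewrite inE eq_sym.
have [-> _|p_neq2 /= ps2] := eqVneq p 2%N; first by rewrite foldr_hecke_hecke2.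
by rewrite IHps.
Qed.

Lemma fps_dilate2_eq0 (f : fps 'F_2) : (fps_dilate2 f == 0) = (f == 0).
Proof.
apply/eqP/eqP => [f0|->]; last exact: fps_dilate2_0.
apply/funext => n; have := congr1 (fun g : fps 'F_2 => g n.*2) f0.
by rewrite /fps_dilate2 odd_double doubleK.
Qed.

(** * Series killed by all products of a given length *)

Lemma killed0 (f : fps 'F_2) : killed_by_products f 0 <-> f = 0.
Proof. by split=> [/(_ [::] erefl erefl)//|-> [] //]. Qed.

Lemma killedS (f : fps 'F_2) d :
  killed_by_products f d -> killed_by_products f d.+1.
Proof.
move=> f_d [//|p ps] /= [ps_d] /andP[_ ps_prime].
by rewrite f_d // hecke0.
Qed.

Lemma killed_leq (f : fps 'F_2) d e : (d <= e)%N ->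
  killed_by_products f d -> killed_by_products f e.
Proof.
by move=> /subnKC <- f_d; elim: (e - d)%N => [|k IHk];
  rewrite ?addn0 // addnS; exact: killedS.
Qed.

Lemma killed_zero d : killed_by_products 0 d.
Proof. by move=> ps _ _; exact: foldr_hecke0. Qed.

Lemma killed_add (f g : fps 'F_2) d :
  killed_by_products f d -> killed_by_products g d -> killed_by_products (f + g) d.
Proof.
move=> f_d g_d ps ps_d ps_prime.
by rewrite foldr_heckeD f_d // g_d // addr0.
Qed.

Lemma killed_dilate2 (f : fps 'F_2) d : f 0%N = 0 ->
  killed_by_products (fps_dilate2 f) d.+1 <-> killed_by_products f d.
Proof.
move=> f0; split=> f_d ps ps_d ps_prime.
  (* Write f as T_2 V f; the last entry of a list acts first, so T_2 is appended to the d given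
     primes. *)
  rewrite -(hecke2_dilate2 f0) -foldr_rcons f_d ?size_rcons ?ps_d //.
  by rewrite all_rcons ps_prime.
have [ps2|ps2] := boolP (2%N \in ps).
  rewrite foldr_hecke_rem2 // hecke2_dilate2 // f_d ?size_rem ?ps_d //.
  by apply/allP => p /mem_rem /(allP ps_prime).
(* Without a 2 in the list, V commutes with all operators; the d innermost ones already kill f, and
   the outermost acts on 0. *)
case: ps ps_d ps_prime ps2 => //= p ps [ps_d] /andP[p_prime ps_prime].
rewrite inE negb_or eq_sym => /andP[p_neq2 ps2].
rewrite foldr_hecke_dilate2 // ?f_d // ?fps_dilate2_0 ?hecke0 //.
apply/allP => l l_ps; apply: odd_prime_neq2; first exact: (allP ps_prime).
by apply: contraNneq ps2 => <-.
Qed.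

(** For odd p, multiplying or dividing an index by p keeps its 2-adic valuation, so l = k. T_2 sends
    part k + 1 to part k and kills part 0, as it reads only even indices. *)
Lemma hecke_val2_part p k (f : fps 'F_2) : prime p ->
  hecke p (fps_val2_part k f) = 0 \/
  exists l, hecke p (fps_val2_part k f) = fps_val2_part l (hecke p f).
Proof.
move=> p_prime; have p_gt0 := prime_gt0 p_prime.
have [->|p_neq2] := eqVneq p 2%N.
  case: k => [|k]; [left|right; exists k]; apply/funext => -[|n] //;
    rewrite /hecke /fps_val2_part muln_gt0 lognM // logn_prime //=.
right; exists k; apply/funext => -[|n] //; rewrite /hecke (negbTE p_neq2) /=.
have p2 : logn 2 p = 0%N by rewrite logn_prime // eq_sym (negbTE p_neq2).
rewrite /fps_val2_part muln_gt0 p_gt0 /= lognM // p2 add0n.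
have [p_n|_] := boolP (p %| n.+1)%N; last by case: eqP; rewrite ?addr0.
have -> : logn 2 (n.+1 %/ p) = logn 2 n.+1 by rewrite logn_div // p2 subn0.
by rewrite divn_gt0 // dvdn_leq //=; case: eqP; rewrite ?addr0.
Qed.

Lemma foldr_hecke_val2_part ps k (f : fps 'F_2) : all prime ps ->
  foldr hecke (fps_val2_part k f) ps = 0 \/
  exists l, foldr hecke (fps_val2_part k f) ps = fps_val2_part l (foldr hecke f ps).
Proof.
elim: ps => [|p ps IHps] /=; first by right; exists k.
move=> /andP[p_prime /IHps[->|[l ->]]]; first by left; exact: hecke0.
exact: hecke_val2_part.
Qed.

Lemma killed_val2_part k (f : fps 'F_2) d :
  killed_by_products f d -> killed_by_products (fps_val2_part k f) d.
Proof.
move=> f_d ps ps_d ps_prime.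
have [//|[l ->]] := foldr_hecke_val2_part k f ps_prime.
by rewrite f_d // fps_val2_part0.
Qed.

(** * The degree of nilpotency in the extended order *)

Lemma nildeg_leP (f : fps 'F_2) (d : nat) :
  reflect (killed_by_products f d) (nildeg f <= (d%:Z)%:E)%E.
Proof.
rewrite /nildeg; case: eqP => [->|_].
  by rewrite leNye; constructor; exact: killed_zero.
case: pselect => [ex|nex]; last first.
  by rewrite leye_eq; constructor=> f_d; apply: nex; exists d; apply/asboolP.
case: ex_minnP => n /asboolP f_n n_min; rewrite lee_fin lez_nat.
apply: (iffP idP) => [n_d|f_d]; first exact: killed_leq f_n.
by apply: n_min; apply/asboolP.
Qed.

(** This turns comparisons of degrees, infinite values included, into implications between killing
    conditions. *)
Lemma nildeg_le (f g : fps 'F_2) :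
  (nildeg f <= nildeg g)%E <->
  (forall d, killed_by_products g d -> killed_by_products f d).
Proof.
split=> [fg d /nildeg_leP g_d|fg]; first by apply/nildeg_leP; exact: le_trans g_d.
rewrite {2}/nildeg; case: eqP => [g0|_].
  (* The empty product kills g = 0, hence also f, which forces f = 0 and degree [-oo]. *)
  have /killed0 -> : killed_by_products f 0 by apply: fg; apply/killed0.
  by rewrite /nildeg eqxx.
case: pselect => [ex|nex]; last exact: leey.
by case: ex_minnP => n /asboolP g_n _; apply/nildeg_leP; exact: fg.
Qed.

Lemma nildeg0 : nildeg 0 = -oo%E.
Proof. by rewrite /nildeg eqxx. Qed.

Lemma nildeg_dilate2 (f : fps 'F_2) : f 0%N = 0 ->
  nildeg (fps_dilate2 f) = (1%:E + nildeg f)%E.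
Proof.
move=> f0; rewrite /nildeg fps_dilate2_eq0.
case: eqP => // f_neq0; case: pselect => [ex|nex]; last first.
  case: pselect => // exf; case: nex; have [d /asboolP f_d] := exf.
  by exists d.+1; apply/asboolP/killed_dilate2.
(* The minimum for V f is not 0: the empty product kills only the zero series. *)
case: ex_minnP => -[|m] /asboolP.
  by move/killed0/eqP; rewrite fps_dilate2_eq0 => /eqP.
move=> Vf_m m_min; have f_m : killed_by_products f m by apply/killed_dilate2.
case: pselect => [exf|[]]; last by exists m; apply/asboolP.
have [n /asboolP f_n n_min] := ex_minnP exf.
suff -> : m = n by rewrite -EFinD -intS.
apply/eqP; rewrite eqn_leq n_min ?andbT; last exact/asboolP.
by rewrite -ltnS m_min //; apply/asboolP/killed_dilate2.
Qed.

Lemma nildeg_iter_dilate2 j (f : fps 'F_2) : f 0%N = 0 ->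
  nildeg (iter j fps_dilate2 f) = ((j%:Z)%:E + nildeg f)%E.
Proof.
move=> f0; elim: j => [|j IHj]; first by rewrite add0e.
rewrite iterS nildeg_dilate2; first by rewrite IHj addeA -EFinD -intS.
by elim: j {IHj} => //= j IHj; rewrite /fps_dilate2.
Qed.

Lemma nildeg_add_le (f g : fps 'F_2) :
  (nildeg (f + g)%R <= maxe (nildeg f) (nildeg g))%E.
Proof.
wlog fg : f g / (nildeg f <= nildeg g)%E => [H|].
  by case/orP: (le_total (nildeg f) (nildeg g)) => /H //; rewrite addrC maxC.
rewrite (max_r fg); apply/nildeg_le => d g_d.
by apply: killed_add => //; move/nildeg_le: fg; apply.
Qed.

Lemma nildeg_sum_le n (F : 'I_n -> fps 'F_2) :
  (nildeg (\sum_(j < n) F j)%R <= \big[maxe/-oo]_(j < n) nildeg (F j))%E.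
Proof.
elim/big_rec2: _ => [|j x f _ fx]; first by rewrite nildeg0.
apply: le_trans (nildeg_add_le _ _) _.
by rewrite ge_max !le_max lexx fx orbT.
Qed.

(** * Iterated dilation and the theorem *)

Lemma iter_dilate2_exp j (f : fps 'F_2) : iter j fps_dilate2 f = f ^+ (2 ^ j).
Proof.
by elim: j => //= j ->; rewrite -fps_sqr_F2 -exprD addnn -mul2n -expnS.
Qed.

Lemma iter_dilate2_sum j (I : finType) (P : pred I) (F : I -> fps 'F_2) :
  iter j fps_dilate2 (\sum_(i | P i) F i) = \sum_(i | P i) iter j fps_dilate2 (F i).
Proof.
elim: j => //= j ->.
exact: (big_morph fps_dilate2 fps_dilate2D fps_dilate2_0).
Qed.

Theorem theorem1p1 (r : nat) (m : 'I_r -> nat)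
  (r_gt0 : (0 < r)%N)
  (m_inj : injective m)
  (m_gt0 : forall i, (0 < m i)%N) :
  let f : fps 'F_2 := \sum_(i < r) Delta ^+ m i in
  let v : nat := (\max_(i < r) logn 2 (m i))%N in
  let f_ (j : nat) : fps 'F_2 :=
    \sum_(i < r | logn 2 (m i) == j) Delta ^+ m i in
  let g_ (j : nat) : fps 'F_2 :=
    \sum_(i < r | logn 2 (m i) == j) Delta ^+ (m i %/ 2 ^ j)%N in
  (forall j : nat, (j <= v)%N ->
     nildeg (f_ j) = ((j%:Z)%:E + nildeg (g_ j))%E)
  /\
  nildeg f = \big[maxe/-oo%E]_(j < v.+1) nildeg (f_ j).
Proof.
move=> f v f_ g_; split=> [j _|].
  have val_dvd i : logn 2 (m i) == j -> (2 ^ j %| m i)%N.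
    by move/eqP <-; rewrite pfactor_dvdn.
  (* It remains to see that [f_ j] is the j-fold dilation of [g_ j], and that [g_ j] has zero
     constant term because its exponents stay positive. *)
  rewrite -nildeg_iter_dilate2.
    rewrite iter_dilate2_sum; congr nildeg; apply: eq_bigr => i /val_dvd j_m.
    by rewrite iter_dilate2_exp -exprM divnK.
  rewrite /g_; elim/big_rec: _ => // i h /val_dvd j_m h0.
  rewrite fps_coefD h0 addr0 Delta_exp0 //.
  by rewrite divn_gt0 ?expn_gt0 // dvdn_leq.
have f_part k : fps_val2_part k f = f_ k.
  rewrite /f_ big_mkcond /= (big_morph _ (fps_val2_partD k) (fps_val2_part0 k)).
  by apply: eq_bigr => i _; exact: fps_val2_part_Delta_exp.
have f_sum : f = \sum_(j < v.+1) f_ j.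
  (* Group the terms by valuation; [inord] is faithful here since every valuation is at most v. *)
  rewrite /f (partition_big (fun i => inord (logn 2 (m i)) : 'I_v.+1) xpredT) //=.
  apply: eq_bigr => j _; apply: eq_bigl => i.
  rewrite -(inj_eq val_inj) /= inordK // ltnS.
  by rewrite /v (bigD1 i) //= leq_maxl.
(* The upper bound is subadditivity; the lower bound holds because [f_ j] is a 2-adic part of f, so
   whatever length kills f kills it too. *)
apply/le_anti/andP; split; first by rewrite {1}f_sum; exact: nildeg_sum_le.
apply/bigmax_leP; split=> [|j _]; first exact: leNye.
by apply/nildeg_le => d; rewrite -f_part; exact: killed_val2_part.
Qed.
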